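(* (i) If $\Lambda$ is not contained in any closed real half-plane whose boundary line passes through the origin, and $U\subseteq D$ is an open set with $1\in\overline{U}$, then for generic $\bm{\lambda}=(\lambda_n)_{n=0}^{\infty}\in\Omega$, the image $f_{\bm{\lambda}}(U)$ is a dense and open subset of $\mathbb{C}$. (ii) If $\Lambda$ is contained in some closed real half-plane whose boundary line passes through the origin, then there exist an open set $U\subseteq D$ with $1\in\overline{U}$ and a closed real half-plane $H\subseteq\mathbb{C}$ such that $f_{\bm{\lambda}}(U)\cap H=\emptyset$ for every $\bm{\lambda}\in\Omega$.
   Context: $D=\{z\in\mathbb{C}:|z|<1\}$ is the open unit disk; $\overline{B}$ denotes the closure of $B\subseteq\mathbb{C}$. $\Lambda\subseteq\mathbb{C}$ is a bounded set with at least two elements, endowed with the subspace topology, and $\Omega=\Omega_\Lambda:=\prod_{n=0}^{\infty}\Lambda$ carries the product topology; it is assumed throughout that $\Omega$ is a Baire space. For $\bm{\lambda}=(\lambda_n)_{n=0}^\infty\in\Omega$, $f_{\bm{\lambda}}(z):=\sum_{n=0}^\infty\lambda_n z^n$, which is holomorphic in $D$. A property holds ''for generic $\bm{\lambda}\in\Omega$'' if the set of $\bm{\lambda}\in\Omega$ for which it holds is residual (its complement is meager) in $\Omega$. A real line is a one-dimensional real affine subspace of $\mathbb{C}$; a real half-plane is one of the two components of the complement of a real line, and its closure is called a closed real half-plane. The closed real half-planes whose boundary line passes through the origin are the sets $\{z\in\mathbb{C}:\operatorname{Im}(e^{-i\alpha}z)\ge 0\}$, $\alpha\in\mathbb{R}$,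 i.e. $\{z:\alpha\le\arg z\le\alpha+\pi\}$ with $0$ included. *)

(* Defs.v *)
From HB Require Import structures.
From mathcomp Require Import all_boot all_order all_algebra.
From mathcomp Require Import all_classical all_reals all_analysis.
From mathcomp Require Import complex.

Set Implicit Arguments.
Unset Strict Implicit.
Unset Printing Implicit Defensive.

Import Order.TTheory GRing.Theory Num.Theory numFieldNormedType.Exports.

Local Open Scope classical_set_scope.
Local Open Scope ring_scope.

(* [R[i]] itself carries no topology; its regular module [R[i]^o] has the
   topology of the modulus. The norm takes its values in the nonnegative reals
   of [R[i]], so that [`|z| < 1], stated in the partial order of [R[i]], is the
   usual inequality between real numbers. *)
Notation cplx R := (R[i]^o).

Section Baire_category.
Context {T : topologicalType}.
Implicit Types A : set T.

Definition nowhere_dense A := interior (closure A) = set0.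

Definition meager A := exists F : (set T)^nat,
  (forall n, nowhere_dense (F n)) /\ A = \bigcup_n F n.

Definition residual A := meager (~` A).

End Baire_category.

Definition baire_space (T : topologicalType) :=
  forall F : (set T)^nat,
    (forall n, open (F n) /\ dense (F n)) -> dense (\bigcap_n F n).

Definition generically (T : topologicalType) (P : T -> Prop) :=
  residual [set x | P x].

Section complex_plane.
Context {R : realType}.
Implicit Types L P H : set (cplx R).

Definition unit_disk : set (cplx R) := [set z | `|z| < 1].

Definition real_line L := exists a b : cplx R,
  b != 0 /\ L = [set a + (t%:C)%C * b | t in [set: R]].

Definition half_plane_of L P := exists z : cplx R,
  (~` L) z /\ P = connected_component (~` L) z.

Definition closed_half_plane_of L H := exists P : set (cplx R),
  half_plane_of L P /\ H = closure P.

Definition closed_half_plane H := exists L,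
  real_line L /\ closed_half_plane_of L H.

Definition closed_half_plane0 H := exists L,
  [/\ real_line L, L 0 & closed_half_plane_of L H].

End complex_plane.

(* The set [Lam], coerced to a type, has the subspace topology, and
   [prod_topology] is the product topology. *)
Definition Omega (R : realType) (Lam : set (cplx R)) : topologicalType :=
  prod_topology (fun _ : nat => (Lam : Type)).

Definition power_series (R : realType) (Lam : set (cplx R)) (lam : Omega Lam)
    (z : cplx R) : cplx R :=
  limn (series (fun n => (set_val (lam n) : cplx R) * z ^+ n)).

(* Main.v *)
Require Import Defs.
From HB Require Import structures.
From mathcomp Require Import all_boot all_order all_algebra.
From mathcomp Require Import all_classical all_reals all_analysis.
From mathcomp Require Import complex.
From mathcomp Require Import ring lra.
Import Order.TTheory GRing.Theory Num.Theory numFieldNormedType.Exports.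
Local Open Scope classical_set_scope.
Local Open Scope ring_scope.

(** Why the theorem is true. Write f for the series with coefficients lam.

    Suppose that Lam lies in no closed half-plane bounded by a line through
    0. Then every direction w has a digit x in Lam with Re (w x) > 0, and by
    compactness of the circle with Re (w x) >= d for one d > 0
    ([uniform_direction]). Now let s be a complex number and |z| < 1 close to
    1. Replacing s by (s - x) / z with a digit x pointing in the direction of
    s keeps s in a fixed disk, and iterating this produces digits with s =
    sum x_n z^n exactly ([greedy_step], [greedy_expansion]). Since a point z
    of U can be taken arbitrarily close to 1, any finite prefix of lam can be
    completed so that f(z) is a prescribed number. For every disk V the set
    of lam such that f(U) meets V is thus dense ([hits_dense]), and it is
    open because f(z) depends continuously on lam ([hits_open]). Intersecting
    over the countably many disks V of [rational_disk] shows that f(U) is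
    dense for generic lam.

    A dense f(U) cannot come from a constant f, so f(U) is then open by the
    open mapping theorem, proved here for power series with bounded
    coefficients ([psum_open]). Such series are stable under difference
    quotients ([psum_quotient]); iterating them gives f(z) = f(w) + (z - w)^k
    q(z) with q(w) <> 0 near every point w of the disk ([local_form]), unless
    f is locally constant at w, which makes f constant
    ([psum_locally_const]). This local form shows that |f - w| has no
    positive local minimum, and openness follows by compactness of closed
    disks.

    Suppose now that Re (w x) >= 0 for all x in Lam. Then Re (w f(x)) >= 0
    for 0 < x < 1, and as f varies slowly, uniformly in lam, Re (w f(z)) >=
    -|w| on a thin neighbourhood of ]0, 1[ ([half_plane_avoided]). *)

Set Implicit Arguments.
Unset Strict Implicit.
Import ComplexField.Normc.
Local Notation Re := complex.Re.
Local Notation Im := complex.Im.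

(** * The real-valued modulus and the topology of the plane *)

Section modulus.
Context {R : realType}.
Implicit Types z w : cplx R.

Lemma normE z : `|z| = ((normc z)%:C)%C.
Proof. by rewrite normc_def; case: z => a b. Qed.

Lemma normc_ge0 z : 0 <= normc z.
Proof. by case: z => a b /=; exact: sqrtr_ge0. Qed.

Lemma normcB z w : normc (z - w) = normc (w - z).
Proof. by rewrite -(opprB z w) -[RHS]normcN opprK. Qed.

Lemma normcX z n : normc (z ^+ n) = normc z ^+ n.
Proof. by elim: n => [|n IH]; rewrite ?expr0 ?normc1 // !exprS normcM IH. Qed.

Lemma normc_gt0 z : z != 0 -> 0 < normc z.
Proof.
move=> z0; rewrite lt_neqAle normc_ge0 andbT eq_sym.
by apply: contra z0 => /eqP /eq0_normc ->.
Qed.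

Lemma normcR (x : R) : normc (x%:C)%C = `|x|.
Proof. by rewrite /normc /= expr0n /= addr0 sqrtr_sqr. Qed.

Lemma le_normcB z w : normc (z - w) <= normc z + normc w.
Proof. by rewrite -[normc w]normcN; exact: le_normcD. Qed.

Lemma ge_normcD z w : normc z - normc w <= normc (z + w).
Proof. by rewrite lerBlDr -{1}(addrK w z); exact: le_normcB. Qed.

Lemma ge_normcB z w : normc z - normc w <= normc (z - w).
Proof. by rewrite -[normc w]normcN; exact: ge_normcD. Qed.

Lemma Re_le_normc z : `|Re z| <= normc z :> R.
Proof. by rewrite -lecR -normE; exact: normc_ge_Re. Qed.

Lemma Im_le_normc z : `|Im z| <= normc z.
Proof.
case: z => a b /=; rewrite -sqrtr_sqr ler_wsqrtr // lerDr; exact: sqr_ge0.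
Qed.

Lemma normc_le_ReIm z : normc z <= `|Re z| + `|Im z|.
Proof.
case: z => a b /=.
rewrite -(ger0_norm (addr_ge0 (normr_ge0 a) (normr_ge0 b))) -[leRHS]sqrtr_sqr.
rewrite ler_wsqrtr // sqrrD !real_normK ?num_real // lerD2r lerDl.
by rewrite mulrn_wge0 // mulr_ge0.
Qed.

Lemma ReD z w : Re (z + w) = Re z + Re w.
Proof. by case: z w => [a b] [c d]. Qed.
Lemma ReN z : Re (- z) = - Re z.
Proof. by case: z => [a b]. Qed.
Lemma ReB z w : Re (z - w) = Re z - Re w.
Proof. by rewrite ReD ReN. Qed.
Lemma ReM z w : Re (z * w) = Re z * Re w - Im z * Im w.
Proof. by case: z w => [a b] [c d]. Qed.
Lemma ReZ z (t : R) : Re (z * (t%:C)%C) = Re z * t.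
Proof. by rewrite ReM /= mulr0 subr0. Qed.

Lemma normc_sq z : normc z ^+ 2 = Re z ^+ 2 + Im z ^+ 2.
Proof.
case: z => a b /=; rewrite sqr_sqrtr //; by rewrite addr_ge0 ?sqr_ge0.
Qed.

Lemma nbhs_normcP z (A : set (cplx R)) :
  nbhs z A <-> exists2 e : R, 0 < e & forall w, normc (w - z) < e -> A w.
Proof.
split.
  move=> /nbhs_ballP[e /= e0 He].
  have [e' ee'] : exists e', e = (e'%:C)%C.
    by exists (Re e); rewrite RRe_real // gtr0_real.
  subst e; exists e'; first by rewrite -ltcR.
  move=> w wz; apply: He; rewrite -ball_normE /= normE ltcR.
  by rewrite normcB.
move=> [e e0 He]; apply/nbhs_ballP; exists (e%:C)%C => /=;
  first by rewrite ltcR.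
move=> w; rewrite -ball_normE /= normE ltcR => wz; apply: He.
by rewrite normcB.
Qed.

Lemma open_normcP (A : set (cplx R)) : open A <->
  forall z, A z -> exists2 e : R, 0 < e & forall w, normc (w - z) < e -> A w.
Proof.
rewrite openE; split => H z /H; first by move/nbhs_normcP.
by move=> ?; apply/nbhs_normcP.
Qed.

Lemma open_disk z (r : R) : open [set w : cplx R | normc (w - z) < r].
Proof.
apply/open_normcP => w /= wz; exists (r - normc (w - z));
  first by rewrite subr_gt0.
move=> v; rewrite ltrBrDr => vw; apply: le_lt_trans vw.
by rewrite -{1}(subrK w v) -addrA le_normcD.
Qed.

Lemma closure_normcP (A : set (cplx R)) z : closure A z <->
  forall e : R, 0 < e -> exists2 w, A w & normc (w - z) < e.
Proof.
split.
  move=> cA e e0; have [|w [Aw /= wz]] := cA [set w | normc (w - z) < e].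
    by apply/nbhs_normcP; exists e.
  by exists w.
move=> H B /nbhs_normcP[e /H[w Aw wz] HB]; exists w; split => //; exact: HB.
Qed.

Lemma cvg_normcP (u : nat -> cplx R) (l : cplx R) : u @ \oo --> l <->
  forall e : R, 0 < e -> exists N, forall n, (N <= n)%N -> normc (u n - l) < e.
Proof.
split.
  move=> ul e e0.
  have : nbhs l [set w | normc (w - l) < e] by apply/nbhs_normcP; exists e.
  by move=> /ul[N _ HN]; exists N => n Nn; exact: HN.
move=> H A /nbhs_normcP[e /H[N HN] HA]; exists N => // n Nn; apply: HA;
  exact: HN.
Qed.

Lemma continuous_normcP (T : topologicalType) (f : T -> cplx R) t :
  {for t, continuous f} <->
  forall e : R, 0 < e -> \forall s \near t, normc (f s - f t) < e.
Proof.
split.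
  move=> ft e e0; have : nbhs (f t) [set w | normc (w - f t) < e].
    by apply/nbhs_normcP; exists e.
  by move=> /ft.
move=> H A /nbhs_normcP[e /H He HA]; apply: filterS He => s; exact: HA.
Qed.

Lemma cvg_normc_lim (u : nat -> cplx R) (l : cplx R) :
  u @ \oo --> l -> limn u = l.
Proof. by move=> ?; apply: cvg_lim => //; exact: norm_hausdorff. Qed.

Lemma unit_diskE z : unit_disk z <-> normc z < 1.
Proof. by rewrite /unit_disk /= normE -[1]/((1:R)%:C)%C ltcR. Qed.

End modulus.

(** * Power series with bounded coefficients *)

(** The sum is sealed so that conversion never unfolds the limit and the
    complex arithmetic below it. *)
HB.lock Definition psum (R : realType) (a : nat -> cplx R) (z : cplx R) :
  cplx R :=
  limn (series (fun n => a n * z ^+ n)).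

Section psum.
Context {R : realType}.
Implicit Types (z w : cplx R) (a c : nat -> cplx R) (M : R).

Definition bounded_by M a := forall n, normc (a n) <= M.

Lemma bounded_by_ge0 M a : bounded_by M a -> 0 <= M.
Proof. by move/(_ 0%N); apply: le_trans; exact: normc_ge0. Qed.

Lemma geometric_dominated_cvg (u : nat -> R) M r : 0 <= r < 1 ->
  (forall n, `|u n| <= M * r ^+ n) -> cvgn (series u).
Proof.
move=> /andP[r0 r1] uM; apply: normed_cvg.
apply: (@series_le_cvg _ _ (geometric M r)) => //.
- by move=> n /=.
- by move=> n /=; exact: le_trans (normr_ge0 _) (uM n).
- by apply: is_cvg_geometric_series; rewrite ger0_norm.
Qed.

(** Absolute convergence is checked on the real and imaginary parts, which
    are dominated by a geometric series. *)
Lemma psum_cvg M a z : bounded_by M a -> normc z < 1 ->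
  series (fun n => a n * z ^+ n) @ \oo --> psum a z.
Proof.
move=> aM z1.
pose t n := a n * z ^+ n.
have tM n : normc (t n) <= M * normc z ^+ n.
  by rewrite normcM normcX ler_wpM2r // exprn_ge0 // normc_ge0.
have z01 : 0 <= normc z < 1 by rewrite normc_ge0.
have cr : cvgn (series (fun n => Re (t n))).
  apply: (@geometric_dominated_cvg _ M (normc z)) => // n.
  exact: le_trans (Re_le_normc _) (tM n).
have ci : cvgn (series (fun n => Im (t n))).
  apply: (@geometric_dominated_cvg _ M (normc z)) => // n.
  exact: le_trans (Im_le_normc _) (tM n).
have tE n : series t n = Complex (series (fun n =>
  Re (t n)) n) (series (fun n => Im (t n)) n).
  rewrite /series /=; elim: n => [|n IH]; first by rewrite !big_geq.
  by rewrite !big_nat_recr //= IH; case: (t n).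
suff H : series t @ \oo -->
    (Complex (limn (series (fun n => Re (t n)))) (limn (series (fun n =>
      Im (t n)))) : cplx R).
  by rewrite psum.unlock (cvg_normc_lim H).
apply/cvg_normcP => e e0; have e2 : 0 < e / 2 by rewrite divr_gt0.
have /cvgrPdist_lt/(_ _ e2)[N1 _ H1] := cr.
have /cvgrPdist_lt/(_ _ e2)[N2 _ H2] := ci.
exists (maxn N1 N2) => n; rewrite geq_max => /andP[n1 n2].
rewrite tE; apply: le_lt_trans (normc_le_ReIm _) _ => /=.
rewrite [e]splitr ltrD // distrC; [exact: H1|exact: H2].
Qed.

Lemma cvg_normc_le (u : nat -> cplx R) (l : cplx R) (B : R) :
  u @ \oo --> l -> (forall n, normc (u n) <= B) -> normc l <= B.
Proof.
move=> ul uB; apply/ler_addgt0Pr => e e0.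
have /cvg_normcP/(_ _ e0)[N /(_ N (leqnn _))] := ul.
rewrite normcB => H; rewrite -(subrK (u N) l) addrC.
by apply: le_trans (le_normcD _ _) _; rewrite lerD // ltW.
Qed.

Lemma psum_eq a z l :
  (forall e : R, 0 < e -> exists N, forall n, (N <= n)%N ->
     normc (series (fun n => a n * z ^+ n) n - l) < e) -> psum a z = l.
Proof. by move=> H; rewrite psum.unlock; apply: cvg_normc_lim;
  apply/cvg_normcP. Qed.

Lemma series_recl (u : nat -> cplx R) n :
  series u n.+1 = u 0%N + series (fun k => u k.+1) n.
Proof. by rewrite /series /= big_nat_recl. Qed.

Lemma series_shift a z n : series (fun n => a n.+1 * z ^+ n.+1) n =
  z * series (fun n => a n.+1 * z ^+ n) n.
Proof.
rewrite /series /= big_distrr /=; apply: eq_bigr => i _.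
by rewrite exprS mulrCA.
Qed.

Lemma bounded_by_shift M a k : bounded_by M a ->
  bounded_by M (fun n => a (k + n)%N).
Proof. by move=> aM n; exact: aM. Qed.

Lemma psum_recl M a z : bounded_by M a -> normc z < 1 ->
  psum a z = a 0%N + z * psum (fun n => a n.+1) z.
Proof.
move=> aM z1.
apply: psum_eq => e e0.
have /cvg_normcP/(_ e e0)[N HN] := psum_cvg (bounded_by_shift 1 aM) z1.
exists N.+1 => -[//|n] Nn; rewrite series_recl expr0 mulr1 series_shift.
rewrite opprD addrACA subrr add0r -mulrBr normcM.
apply: le_lt_trans (HN n Nn).
by rewrite ler_piMl ?normc_ge0 // ltW.
Qed.

Lemma psum_split M a z N : bounded_by M a -> normc z < 1 ->
  psum a z = series (fun n => a n * z ^+ n) N +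
    z ^+ N * psum (fun n => a (N + n)%N) z.
Proof.
move=> aM z1; elim: N => [|N IH].
  by rewrite /series /= big_geq // add0r expr0 mul1r.
rewrite IH (psum_recl (bounded_by_shift N aM) z1) seriesEnat /= big_nat_recr
  //=.
rewrite addn0 -!addrA; congr (_ + _); rewrite mulrDr mulrC; congr (_ + _).
rewrite mulrA -exprSr; congr (_ * psum _ _).
by apply/funext => n; rewrite addnS.
Qed.

Lemma psum_le M a z : bounded_by M a -> normc z < 1 ->
  normc (psum a z) <= M / (1 - normc z).
Proof.
move=> aM z1; have z1' : 0 < 1 - normc z by rewrite subr_gt0.
have M0 := bounded_by_ge0 aM; have z0 := normc_ge0 z.
have partial n : normc (series (fun n => a n * z ^+ n) n) <= M / (1 - normc z).
  suff H : normc (series (fun n => a n * z ^+ n) n) * (1 - normc z)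
      <= M * (1 - normc z ^+ n).
    rewrite ler_pdivlMr //; apply: le_trans H _.
    by rewrite ler_piMr // gerBl exprn_ge0.
  elim: n => [|n IH].
    by rewrite /series /= big_geq // normc0 mul0r expr0 subrr mulr0.
  rewrite seriesEnat /= big_nat_recr //=.
  apply: (@le_trans _ _ ((normc (series (fun n => a n * z ^+ n) n)
     + M * normc z ^+ n) * (1 - normc z))).
    rewrite ler_wpM2r ?(ltW z1') //; apply: le_trans (le_normcD _ _) _.
    by rewrite lerD2l normcM normcX ler_wpM2r // exprn_ge0.
  by rewrite mulrDl exprS; lra.
exact: cvg_normc_le (psum_cvg aM z1) partial.
Qed.

(** The recurrence psum_recl turns an identity between bounded quantities
    that depend on the tail of the coefficients into d n = z * d n.+1; then d
    0 = z^n * d n tends to 0, so the identity holds without taking any limit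
    of partial sums. *)
Lemma contraction_eq0 (d : nat -> cplx R) z K : normc z < 1 ->
  bounded_by K d -> (forall n, d n = z * d n.+1) -> d 0%N = 0.
Proof.
move=> z1 dK dS; have K0 := bounded_by_ge0 dK; have z0 := normc_ge0 z.
have dE n : d 0%N = z ^+ n * d n.
  elim: n => [|n IH]; first by rewrite expr0 mul1r.
  by rewrite IH dS mulrA exprSr.
apply: eq0_normc; apply/eqP; rewrite eq_le normc_ge0 andbT.
apply/ler_addgt0Pr => e e0; rewrite add0r.
have K1 : 0 < K + 1 by rewrite ltr_wpDl.
have : geometric 1 (normc z) @ \oo --> (0 : R).
  by apply: cvg_geometric; rewrite ger0_norm.
move=> /cvgrPdist_lt/(_ (e / (K + 1)))[]; first by rewrite divr_gt0.
move=> n _ /(_ n (leqnn n)) /=;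
  rewrite sub0r mul1r normrN ger0_norm ?exprn_ge0 //.
rewrite ltr_pdivlMr // => /ltW; apply: le_trans.
rewrite (dE n) normcM normcX ler_wpM2l ?exprn_ge0 //.
by rewrite (le_trans (dK n)) // lerDl.
Qed.

(** The remainders s of a digit expansion of s 0 in base 1/z stay bounded, so
    the expansion converges to s 0. *)
Lemma psum_greedy M a z (s : nat -> cplx R) (rho : R) : bounded_by M a ->
  z != 0 -> normc z < 1 -> bounded_by rho s ->
  (forall n, s n.+1 = (s n - a n) / z) -> psum a z = s 0%N.
Proof.
move=> aM z0 z1 srho sS; apply/eqP; rewrite -subr_eq0; apply/eqP.
pose d n := psum (fun k => a (n + k)%N) z - s n.
apply: (@contraction_eq0 d z (M / (1 - normc z) + rho)) => // n.
  rewrite (le_trans (le_normcB _ _)) // lerD //.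
  by apply: psum_le => //; exact: bounded_by_shift.
have shS : (fun k => a (n + k.+1)%N) = (fun k => a (n.+1 + k)%N).
  by apply/funext => k; rewrite addnS.
rewrite /d (psum_recl (bounded_by_shift n aM) z1) addn0 shS sS.
by field.
Qed.

(** The coefficients of the difference quotient (f(z) - f(w)) / (z - w): its
    j-th coefficient is the value at w of the series shifted j + 1 times. *)
Definition quotient w a : nat -> cplx R :=
  fun j => psum (fun n => a (j.+1 + n)%N) w.

(** Bounded coefficients survive the division by z - w: this class of series
    is thus closed under taking difference quotients, which replaces Taylor
    expansions at centres other than 0. *)
Lemma bounded_by_quotient M a w : bounded_by M a -> normc w < 1 ->
  bounded_by (M / (1 - normc w)) (quotient w a).
Proof. by move=> aM w1 j; apply: psum_le => //; exact: bounded_by_shift. Qed.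

(** Both sides satisfy the same recurrence under shifting a, so their
    difference vanishes by contraction_eq0. *)
Lemma psum_quotient M a w z : bounded_by M a -> normc w < 1 -> normc z < 1 ->
  psum a z = psum a w + (z - w) * psum (quotient w a) z.
Proof.
move=> aM w1 z1; apply/eqP; rewrite -subr_eq0; apply/eqP.
pose sh n k := a (n + k)%N.
pose d n := psum (sh n) z - (psum (sh n) w + (z - w) * psum (quotient w (sh n))
  z).
pose B u := M / (1 - normc u).
have shM n : bounded_by M (sh n) := bounded_by_shift n aM.
have shS n : (fun k => sh n k.+1) = sh n.+1 by apply/funext => k;
  rewrite /sh addnS.
apply: (@contraction_eq0 d z (B z + (B w + normc (z - w) * (B w / (1 - normc
  z))))) => // n.
  rewrite (le_trans (le_normcB _ _)) // lerD ?psum_le //.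
  rewrite (le_trans (le_normcD _ _)) // lerD ?psum_le // normcM.
  by rewrite ler_wpM2l ?normc_ge0 // psum_le //; exact: bounded_by_quotient.
have qS : (fun k => quotient w (sh n) k.+1) = quotient w (sh n.+1).
  apply/funext => k; congr (psum _ _); apply/funext => j.
  by rewrite /sh; congr a; rewrite !addnS.
have q0 : quotient w (sh n) 0%N = psum (sh n.+1) w.
  by congr (psum _ _); apply/funext => j; rewrite /sh; congr a; rewrite addnS.
rewrite /d (psum_recl (shM n) z1) (psum_recl (shM n) w1).
rewrite (psum_recl (bounded_by_quotient (shM n) w1) z1) !shS qS q0.
move: (psum _ z) (psum _ w) (psum _ z) (sh n 0%N) => P Q S c; ring.
Qed.

Lemma psum_lipschitz M a w z : bounded_by M a -> normc w < 1 -> normc z < 1 ->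
  normc (psum a z - psum a w) <= normc (z - w) * (M / (1 - normc w) / (1 -
    normc z)).
Proof.
move=> aM w1 z1; rewrite (psum_quotient aM w1 z1) addrAC subrr add0r normcM.
by rewrite ler_wpM2l ?normc_ge0 // psum_le //; exact: bounded_by_quotient.
Qed.

Lemma unit_disk_near w : normc w < 1 -> forall z,
  normc (z - w) < (1 - normc w) / 2 ->
  normc z < 1 /\ (1 - normc w) / 2 <= 1 - normc z.
Proof.
move=> w1 z zw; have := le_normcD (z - w) w; rewrite subrK => H.
by split; lra.
Qed.

Lemma psum_continuous M a w : bounded_by M a -> normc w < 1 ->
  {for w, continuous (psum a)}.
Proof.
move=> aM w1; apply/continuous_normcP => e e0; have M0 := bounded_by_ge0 aM.
have w1' : 0 < 1 - normc w by rewrite subr_gt0.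
set K := M / (1 - normc w) / ((1 - normc w) / 2).
have K0 : 0 <= K by rewrite !divr_ge0 // ltW.
have K1 : 0 < K + 1 by rewrite ltr_wpDl.
have d0 : 0 < Num.min ((1 - normc w) / 2) (e / (K + 1)).
  by rewrite lt_min !divr_gt0.
apply/nbhs_normcP; exists (Num.min ((1 - normc w) / 2) (e / (K + 1))) => // z.
rewrite lt_min => /andP[/(unit_disk_near w1)[z1 zd] ze].
apply: le_lt_trans (psum_lipschitz aM w1 z1) _.
apply: (@le_lt_trans _ _ (normc (z - w) * (K + 1))); last first.
  by rewrite -ltr_pdivlMr.
rewrite ler_wpM2l ?normc_ge0 // (le_trans _ (_ : K <= _)) ?lerDl //.
have z1' : 0 < 1 - normc z by rewrite subr_gt0.
rewrite /K ler_wpM2l //; first by rewrite divr_ge0 // ltW.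
by rewrite lef_pV2 // posrE divr_gt0.
Qed.

Lemma bounded_by_iter_quotient M a w k : bounded_by M a -> normc w < 1 ->
  bounded_by (M / (1 - normc w) ^+ k) (iter k (quotient w) a).
Proof.
move=> aM w1; elim: k => [|k IH]; first by rewrite expr0 divr1.
by rewrite iterS exprSr invfM mulrA; exact: bounded_by_quotient.
Qed.

Lemma psum_iter_quotient M a w k : bounded_by M a -> normc w < 1 ->
  (forall j, (0 < j < k)%N -> psum (iter j (quotient w) a) w = 0) ->
    (0 < k)%N ->
  forall z, normc z < 1 ->
  psum a z = psum a w + (z - w) ^+ k * psum (iter k (quotient w) a) z.
Proof.
move=> aM w1; elim: k => [//|[|k] IH] H _ z z1.
  by rewrite (psum_quotient aM w1 z1) expr1.
rewrite IH //; last by move=> j /andP[j0 jk]; apply: H; rewrite j0 ltnW.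
rewrite (psum_quotient (bounded_by_iter_quotient k.+1 aM w1) w1 z1).
by rewrite H ?ltnSn // add0r mulrA -exprSr.
Qed.

(** Divide by z - w until the quotient does not vanish at w. If it always
    does, f(z) - f(w) = (z - w)^n q_n(z) for all n, where |q_n(z)| is at most
    a constant times (1 - |w|)^-n; this forces f(z) = f(w) in the disk of
    radius 1 - |w|. *)
Lemma local_form M a w : bounded_by M a -> normc w < 1 ->
  (exists k, [/\ (0 < k)%N, psum (iter k (quotient w) a) w != 0 &
     forall z, normc z < 1 ->
       psum a z = psum a w + (z - w) ^+ k * psum (iter k (quotient w) a) z])
  \/ (forall z, normc (z - w) < 1 - normc w -> psum a z = psum a w).
Proof.
move=> aM w1.
have [ex|nex] := pselect (exists k,
  (0 < k)%N && (psum (iter k (quotient w) a) w != 0)).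
  left; have [k /andP[k0 kn0] kmin] := ex_minnP ex; exists k; split => //.
  apply: psum_iter_quotient => // j /andP[j0 jk]; apply/eqP;
    apply: contraPT jk => jn0.
  by apply/negP; rewrite -leqNgt kmin // j0.
right => z zw.
have z1 : normc z < 1.
  by have := le_normcD (z - w) w; rewrite subrK; move: zw; lra.
apply/eqP; rewrite -subr_eq0; apply/eqP.
have w1' : 0 < 1 - normc w by rewrite subr_gt0.
have q0 j : (0 < j)%N -> psum (iter j (quotient w) a) w = 0.
  by move=> j0; apply/eqP; apply: contrapT => /negP jn0; apply: nex; exists j;
    rewrite j0.
pose r : cplx R := (z - w) / ((1 - normc w)%:C)%C.
have nr : normc r < 1.
  by rewrite normcM normcV normcR ger0_norm ?(ltW w1') // ltr_pdivrMr // mul1r.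
pose t : cplx R := ((1 - normc w)%:C)%C.
have t0 : t != 0 by rewrite (inj_eq (@complexI _) _ 0) gt_eqF.
pose d n := t ^+ n.+1 * psum (iter n.+1 (quotient w) a) z.
suff /eqP : d 0%N = 0.
  rewrite mulf_eq0 expr1 (negPf t0) /= => /eqP q1.
  by rewrite (psum_quotient aM w1 z1) q1 mulr0 addr0 subrr.
apply: (@contraction_eq0 d r (M / (1 - normc z))) => // n.
  have q := psum_le (bounded_by_iter_quotient n.+1 aM w1) z1.
  have tn : 0 < (1 - normc w) ^+ n.+1 by rewrite exprn_gt0.
  rewrite normcM normcX normcR gtr0_norm // mulrC -ler_pdivlMr //.
  by rewrite mulrAC.
rewrite /d (psum_quotient (bounded_by_iter_quotient n.+1 aM w1) w1 z1) q0 //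
  add0r.
rewrite [t ^+ n.+2]exprS -iterS /r -/t.
move: (t ^+ n.+1) (psum _ z) => T Q; move: (t) (t0) => t1 t10.
by field.
Qed.

Lemma psum0 a M : bounded_by M a -> psum a 0 = a 0%N.
Proof. by move=> aM; rewrite (psum_recl aM) ?normc0 // mul0r addr0. Qed.

Lemma psum_punctured_eq0 M a (r : R) : bounded_by M a -> 0 < r ->
  (forall z, z != 0 -> normc z < r -> psum a z = 0) -> psum a 0 = 0.
Proof.
move=> aM r0 H; apply: eq0_normc; apply/eqP; rewrite eq_le normc_ge0 andbT.
apply/ler_addgt0Pr => e e0; rewrite add0r.
have n01 : normc (0 : cplx R) < 1 by rewrite normc0.
have /continuous_normcP/(_ e e0)/nbhs_normcP[d d0 Hd] := psum_continuous aM n01.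
have m0 : 0 < Num.min d r by rewrite lt_min d0.
pose z : cplx R := ((Num.min d r / 2)%:C)%C.
have nz : normc z = Num.min d r / 2 by rewrite normcR gtr0_norm // divr_gt0.
have md : Num.min d r / 2 < Num.min d r
  by rewrite ltr_pdivrMr // ltr_pMr // ltr1n.
have /andP[zd zr] : (normc z < d) && (normc z < r) by rewrite -lt_min nz.
have zn0 : z != 0 by apply/eqP => z0; move: nz; rewrite z0 normc0; move: m0;
  lra.
have := Hd z; rewrite subr0 => /(_ zd).
by rewrite H // add0r normcN => /ltW.
Qed.

Lemma psum_shift_eq0 M a (r : R) : bounded_by M a -> r <= 1 ->
  (forall z, normc z < r -> psum a z = psum a 0) ->
  forall z, z != 0 -> normc z < r -> psum (fun n => a n.+1) z = 0.
Proof.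
move=> aM r1 H z z0 zr; have z1 := lt_le_trans zr r1; move: (H z zr).
rewrite (psum_recl aM z1) (psum0 aM) => /eqP.
by rewrite addrC -subr_eq0 addrK mulf_eq0 (negPf z0) => /eqP.
Qed.

Lemma psum_const_near0 M a (r : R) : bounded_by M a -> 0 < r <= 1 ->
  (forall z, normc z < r -> psum a z = psum a 0) -> forall n, a n.+1 = 0.
Proof.
move=> aM /andP[r0 r1] H n; elim: n a aM H => [|n IH] a aM H;
  have sM := bounded_by_shift 1 aM; have sz := psum_shift_eq0 aM r1 H;
  have s0 := psum_punctured_eq0 sM r0 sz.
  by rewrite -(psum0 sM).
apply: (IH (fun n => a n.+1)) => // z zr.
by have [->//|z0] := eqVneq z 0; rewrite sz // s0.
Qed.

(** The identity theorem: local constancy at w is carried along a geometric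
    sequence of centres down to 0, where the coefficients can be read off. *)
Lemma psum_locally_const M a w (r : R) : bounded_by M a -> normc w < 1 ->
  0 < r ->
  (forall z, normc (z - w) < r -> psum a z = psum a w) ->
  forall n, a n.+1 = 0.
Proof.
move=> aM w1 r0 wr.
(* Near v the first alternative of local_form would force its nonzero factor
   to vanish, so local constancy at v spreads to the disk of radius 1 - |v|. *)
have spread v (e : R) : normc v < 1 -> 0 < e ->
    (forall z, normc (z - v) < e -> psum a z = psum a v) ->
    forall z, normc (z - v) < 1 - normc v -> psum a z = psum a v.
  move=> v1 e0 ve; have [[k [k0 qn0 form]]|//] := local_form aM v1.
  exfalso; move/eqP: qn0; apply.
  have v1' : 0 < 1 - normc v by rewrite subr_gt0.
  have qM := bounded_by_iter_quotient k aM v1.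
  apply: eq0_normc; apply/eqP; rewrite eq_le normc_ge0 andbT.
  apply/ler_addgt0Pr => eps eps0; rewrite add0r.
  have /continuous_normcP/(_ _ eps0)/nbhs_normcP[d d0 Hd] :=
    psum_continuous qM v1.
  pose m := Num.min (Num.min d e) (1 - normc v).
  have m0 : 0 < m by rewrite !lt_min d0 e0.
  have m2 : 0 < m / 2 by rewrite divr_gt0.
  have mm : m / 2 < m by lra.
  have := mm; rewrite {2}/m !lt_min => /andP[/andP[md me] m1].
  pose z := v + ((m / 2)%:C)%C.
  have zv : z - v = ((m / 2)%:C)%C by rewrite /z addrC addKr.
  have nzv : normc (z - v) = m / 2 by rewrite zv normcR gtr0_norm.
  have z1 : normc z < 1.
    by rewrite (le_lt_trans (le_normcD _ _)) // normcR gtr0_norm //; lra.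
  have := form z z1; rewrite ve ?nzv // => /eqP.
  rewrite eq_sym [X in X == _]addrC -subr_eq0 addrK mulf_eq0 expf_eq0 k0 /=.
  have zv0 : z - v != 0.
    by apply/eqP => zv0; move: nzv; rewrite zv0 normc0; move: m2; lra.
  rewrite (negPf zv0) => /eqP qz.
  by have := Hd z; rewrite nzv qz add0r normcN => /(_ md) /ltW.
pose t := (1 + normc w) / 2.
have w0 := normc_ge0 w.
have /andP[t0 t1] : 0 < t < 1 by rewrite /t; lra.
(* The ratio t is close enough to 1 for each centre t^n w to lie in the disk
   of constancy of the previous one; these centres tend to 0. *)
pose c n : cplx R := w * ((t ^+ n)%:C)%C.
have tn n : 0 < t ^+ n <= 1 by rewrite exprn_gt0 //= exprn_ile1 // ltW.
have nc n : normc (c n) = normc w * t ^+ n.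
  by rewrite normcM normcR gtr0_norm //; case/andP: (tn n).
have c1 n : normc (c n) <= normc w.
  by rewrite nc ler_piMr //; case/andP: (tn n).
have walk n : exists2 e : R, 0 < e & forall z,
  normc (z - c n) < e -> psum a z = psum a (c n).
  elim: n => [|n [e e0 IH]]; first by exists r => // z;
    rewrite /c expr0 mulr1; exact: wr.
  have cn1 := le_lt_trans (c1 n) w1.
  have S := spread _ _ cn1 e0 IH.
  have near : normc (c n.+1 - c n) < 1 - normc (c n).
    have -> : c n.+1 - c n = c n * ((t - 1)%:C)%C.
      rewrite /c -mulrBr -mulrA -rmorphB -rmorphM exprS; congr (_ * (_%:C)%C);
        ring.
    rewrite normcM normcR ler0_norm; last by lra.
    have := c1 n; have := normc_ge0 (c n); rewrite /t; nra.
  exists (1 - normc (c n) - normc (c n.+1 - c n)); first by rewrite subr_gt0.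
  move=> z zc; rewrite S ?[RHS]S //.
  rewrite -[z](subrK (c n.+1)) -addrA (le_lt_trans (le_normcD _ _)) //.
  by move: zc; lra.
have : geometric 1 t @ \oo --> (0 : R) by apply: cvg_geometric;
  rewrite gtr0_norm.
move=> /cvgrPdist_lt/(_ (1 / 2))[]; first by rewrite divr_gt0.
move=> n _ /(_ n (leqnn n)) /=;
  rewrite sub0r mul1r normrN gtr0_norm ?exprn_gt0 // => tn2.
have cn2 : normc (c n) < 1 / 2.
  by rewrite nc; have /andP[tp _] := tn n; nra.
have cn1 : normc (c n) < 1 by lra.
have [e e0 /(spread _ _ cn1 e0) S] := walk n.
(* The disk of radius 1 - |c n| about c n contains one about 0. *)
apply: (@psum_const_near0 M a (1 - 2 * normc (c n))) => //.
  by have := normc_ge0 (c n); lra.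
move=> z zr; rewrite S ?[RHS]S //; first by rewrite sub0r normcN; lra.
by rewrite (le_lt_trans (le_normcB _ _)) //; lra.
Qed.

End psum.

(** * The open mapping theorem *)

Section open_mapping.
Context {R : realType}.
Implicit Types (z w : cplx R) (a c : nat -> cplx R) (M : R).

Lemma dist_normc z w : `|normc z - normc w| <= normc (z - w) :> R.
Proof.
rewrite ler_norml ge_normcB andbT lerNl opprB normcB; exact: ge_normcB.
Qed.

Lemma closed_disk_compact w (r : R) : compact [set z : cplx R | normc (z - w)
  <= r].
Proof.
pose F (p : R * R) : cplx R := Complex p.1 p.2.
pose box (x : R) := [set` `[x - r, x + r]].
have cF : continuous F.
  move=> p; apply/continuous_normcP => e e0.
  have e2 : 0 < e / 2 by rewrite divr_gt0.
  have H : \forall q \near p, `|p - q| < e / 2.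
    by apply/nbhs_normP; exists (e / 2).
  apply: filterS H => q; rewrite distrC prod_normE /= gt_max => /andP[H1 H2].
  by apply: le_lt_trans (normc_le_ReIm (F q - F p)) _; rewrite [e]splitr ltrD.
have cB : compact (F @` (box (Re w) `*` box (Im w))).
  apply: continuous_compact; first by apply: continuous_subspaceT.
  by apply: compact_setX; exact: segment_compact.
apply: subclosed_compact cB _; last first.
  move=> z /= zr; exists (Re z, Im z); last by case: z zr.
  have Hr : `|Re z - Re w| <= r.
    by rewrite -ReB (le_trans (Re_le_normc _)).
  have Hi : `|Im z - Im w| <= r.
    have -> : Im z - Im w = Im (z - w) by case: (z) (w) => ? ? [].
    by rewrite (le_trans (Im_le_normc _)).
  move: Hr Hi; rewrite !ler_distl /box /= !in_itv /= =>
    /andP[-> ->] /andP[-> ->].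
  by [].
rewrite -[X in closed X]setCK; apply: open_closedC;
  apply/open_normcP => z /= /negP.
rewrite -ltNge => zr; exists (normc (z - w) - r); first by rewrite subr_gt0.
move=> v vz; apply/negP; rewrite -ltNge.
have -> : v - w = (z - w) + (v - z) by ring.
by have := ge_normcD (z - w) (v - z); lra.
Qed.

(** Minimum modulus principle. With f(z) = f(z0) + (z - z0)^k q(z), where
    q(z0) = c <> 0, a k-th root h of a small positive multiple of -(f(z0) - w) /
    c moves f(z) towards w. *)
Lemma psum_descent M a z0 w (e : R) : bounded_by M a -> normc z0 < 1 ->
  ~ (forall n, a n.+1 = 0) -> psum a z0 != w -> 0 < e ->
  exists2 z, normc (z - z0) < e & normc (psum a z - w) < normc (psum a z0 - w).
Proof.
move=> aM z01 anc g0 e0.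
have z01' : 0 < 1 - normc z0 by rewrite subr_gt0.
have [[k [k0 c0 form]]|lc] := local_form aM z01; last first.
  by case: anc; exact: psum_locally_const aM z01 z01' lc.
set c := psum _ z0 in c0; set q := psum (iter _ _ _) in c0 form.
have nc0 : 0 < normc c := normc_gt0 c0.
pose g := psum a z0 - w.
have g00 : g != 0 by rewrite subr_eq0.
(* The direction along which c h^k points opposite to psum a z0 - w. *)
pose u : cplx R := k.-root ((- (g / c)) : R[i]).
have uk : u ^+ k = - (g / c) by rewrite /u rootCK.
have /continuous_normcP/(_ _ nc0)/nbhs_normcP[d d0 Hd] :=
  psum_continuous (bounded_by_iter_quotient k aM z01) z01.
pose m := Num.min (Num.min d e) (1 - normc z0).
have m0 : 0 < m by rewrite !lt_min d0 e0.
have u0 : 0 <= normc u := normc_ge0 u.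
(* Any s in ]0, 1] with s |u| < m serves. *)
pose s := m / (1 + m + normc u).
have D0 : 0 < 1 + m + normc u by lra.
have s0 : 0 < s by rewrite divr_gt0.
have s1 : s <= 1 by rewrite ler_pdivrMr //; lra.
have su : s * normc u < m by rewrite mulrAC ltr_pdivrMr // ltr_pM2l //; lra.
pose h : cplx R := u * (s%:C)%C.
have nh : normc h < m by rewrite normcM normcR gtr0_norm // mulrC.
have := nh; rewrite {1}/m !lt_min => /andP[/andP[hd he] h1].
exists (z0 + h); first by rewrite addrAC subrr add0r.
have zh1 : normc (z0 + h) < 1 by rewrite (le_lt_trans (le_normcD _ _)) //; lra.
have qc : normc (q (z0 + h) - c) < normc c by apply: Hd;
  rewrite addrAC subrr add0r.
have sk0 : 0 < s ^+ k by rewrite exprn_gt0.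
have sk1 : s ^+ k <= 1 by rewrite exprn_ile1 // ltW.
have key (G C Q T : cplx R) : C != 0 ->
    G + - (G / C) * T * Q = G * (1 - T) - (G * T) * ((Q - C) / C).
  by move=> C0; field.
have -> : psum a (z0 + h) - w =
    g * ((1 - s ^+ k)%:C)%C - (g * ((s ^+ k)%:C)%C) * ((q (z0 + h) - c) / c).
  rewrite form // [z0 + h - z0]addrAC subrr add0r exprMn uk rmorphB rmorphXn
    rmorph1 /=.
  rewrite -/g addrAC -/g.
  by rewrite [in X in _ = _ - X]rmorphXn; exact: key.
rewrite (le_lt_trans (le_normcB _ _)) // !normcM normcV !normcR.
rewrite (gtr0_norm sk0) ger0_norm ?subr_ge0 //.
have lt1 : normc (q (z0 + h) - c) / normc c < 1 by rewrite ltr_pdivrMr // mul1r.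
rewrite -/g; have gp := normc_gt0 g00.
rewrite -mulrA -mulrDr gtr_pMr //.
by nra.
Qed.

(** Open mapping theorem. On a small circle around z1 the values stay away
    from f(z1); for w close to f(z1) the minimum of |f - w| over the closed
    disk is therefore interior, and psum_descent makes it zero. *)
Lemma psum_open M a (U : set (cplx R)) : bounded_by M a ->
  ~ (forall n, a n.+1 = 0) -> open U -> U `<=` unit_disk -> open (psum a @` U).
Proof.
move=> aM anc /open_normcP oU UD; apply/open_normcP => _ [z1 Uz1 <-].
have z11 : normc z1 < 1 by apply/unit_diskE; exact: UD.
have z11' : 0 < 1 - normc z1 by rewrite subr_gt0.
have [e e0 He] := oU _ Uz1.
have [[k [k0 c0 form]]|lc] := local_form aM z11; last first.
  by case: anc; exact: psum_locally_const aM z11 z11' lc.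
set c := psum _ z1 in c0; set q := psum (iter _ _ _) in c0 form.
have nc0 : 0 < normc c / 2 by rewrite divr_gt0 // normc_gt0.
have /continuous_normcP/(_ _ nc0)/nbhs_normcP[d d0 Hd] :=
  psum_continuous (bounded_by_iter_quotient k aM z11) z11.
pose r := Num.min d e / 2.
have m0 : 0 < Num.min d e by rewrite lt_min d0.
have r0 : 0 < r by rewrite divr_gt0.
have /andP[rd re] : (r < d) && (r < e) by rewrite -lt_min /r; lra.
have inU z : normc (z - z1) <= r -> U z by move=> zr; apply: He;
  exact: le_lt_trans re.
have inD z : normc (z - z1) <= r -> normc z < 1.
  by move=> zr; apply/unit_diskE; apply: UD; exact: inU.
pose delta := r ^+ k * (normc c / 2).
have delta0 : 0 < delta by rewrite mulr_gt0 // exprn_gt0.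
have edge z : normc (z - z1) = r -> delta <= normc (psum a z - psum a z1).
  move=> zr; rewrite form; last by apply: inD; rewrite zr.
  rewrite [_ + _ - _]addrAC subrr add0r normcM normcX zr ler_pM2l ?exprn_gt0 //.
  have := Hd z; rewrite zr => /(_ rd); rewrite -/q -/c => H.
  have -> : q z = c + (q z - c) by rewrite addrC subrK.
  by have := ge_normcD c (q z - c); lra.
exists (delta / 2) => [|w wz]; first by rewrite divr_gt0.
pose h z : R := normc (psum a z - w).
pose B := [set z : cplx R | normc (z - z1) <= r].
have Bz1 : B z1 by rewrite /B /= subrr normc0 ltW.
have [||z0 zB hmin] := @compact_EVT_min _ _ h B _ (@closed_disk_compact z1 r).
- by exists z1.
- apply: continuous_in_subspaceT => z /set_mem Bz.
  have := psum_continuous aM (inD _ Bz) => /continuous_normcP pc.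
  move=> A /nbhs_ballP[eps /= eps0 HA];
    apply: (@filterS _ (nbhs z) _ _ _ _ (pc _ eps0)) => v vz.
  apply: HA; rewrite -ball_normE /=; apply: le_lt_trans vz.
  rewrite /h distrC (le_trans (dist_normc _ _)) //.
  by rewrite opprB addrA subrK.
have {}zB : B z0 by move: zB; rewrite ?inE.
exists z0; first exact: inU.
apply/eqP; apply: contraT => nz.
(* On the circle the values stay away from w more than psum a z1 does. *)
have lt_r : normc (z0 - z1) < r.
  rewrite lt_neqAle zB andbT; apply/eqP => /edge E.
  have := hmin z1; rewrite ?inE => /(_ Bz1);
    rewrite /h [X in _ <= X]normcB => E2.
  have := le_normcD (psum a z0 - w) (w - psum a z1); rewrite addrA subrK; lra.
have [|z zz0 hz] := psum_descent aM (inD _ zB) anc nz (e :=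
  r - normc (z0 - z1)).
  by rewrite subr_gt0.
have Bz : B z.
  rewrite /B /=; have -> : z - z1 = (z - z0) + (z0 - z1) by ring.
  by have := le_normcD (z - z0) (z0 - z1); lra.
have := hmin z; rewrite ?inE => /(_ Bz); rewrite /h => H.
by have := le_lt_trans H hz; rewrite ltxx.
Qed.

End open_mapping.

(** * Lines and half-planes *)

Section half_planes.
Context {R : realType}.
Implicit Types (z w x : cplx R) (c : R).

(** Real lines are the level sets of the linear forms x |-> Re (w * x), w <>
    0, and half-planes their superlevel sets. *)
Definition level w c : set (cplx R) := [set x | Re (w * x) = c].
Definition above w c : set (cplx R) := [set x | c < Re (w * x)].

Lemma continuous_linform w : continuous (fun x : cplx R => Re (w * x)).
Proof.
move=> x A /nbhs_ballP[e /= e0 HA].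
have w1 : 0 < normc w + 1 by rewrite ltr_wpDl // normc_ge0.
apply/nbhs_normcP; exists (e / (normc w + 1)); first by rewrite divr_gt0.
move=> y yx; apply: HA; rewrite -ball_normE /=.
rewrite distrC -ReB -mulrBr (le_lt_trans (Re_le_normc _)) // normcM.
move: yx; rewrite ltr_pdivlMr // mulrC; apply: le_lt_trans.
by rewrite ler_wpM2r ?normc_ge0 // lerDl.
Qed.

Lemma continuous_segment z x : continuous (fun t : R =>
  z + (t%:C)%C * (x - z) : cplx R).
Proof.
move=> t; apply/continuous_normcP => e e0.
have K1 : 0 < normc (x - z) + 1 by rewrite ltr_wpDl // normc_ge0.
apply/nbhs_ballP; exists (e / (normc (x - z) + 1)) => /=;
  first by rewrite divr_gt0.
move=> s; rewrite -ball_normE /= => st.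
rewrite opprD addrACA subrr add0r -mulrBl -rmorphB normcM normcR distrC.
move: st; rewrite ltr_pdivlMr //; apply: le_lt_trans.
by rewrite ler_wpM2l // lerDl.
Qed.

(** The linear form maps a connected set avoiding the line to an interval
    that avoids c; conversely segments join the points of one side. *)
Lemma component_above w c z : above w c z ->
  connected_component (~` level w c) z = above w c.
Proof.
rewrite /above /level /= => zc; apply/seteqP; split => x /=.
  move=> xC; rewrite ltNge; apply/negP => xle.
  have cC := @component_connected _ (~` level w c) z.
  have := connected_continuous_connected cC
    (continuous_subspaceT (@continuous_linform w)).
  move=> /connected_intervalP iI.
  have [y yC yc] : [set Re (w * y) | y in connected_component (~` level w c) z]
    c.
    apply: (iI (Re (w * x)) (Re (w * z))); [by exists x| |by rewrite xle ltW].
    by exists z => //; apply: connected_component_refl => /= zl; move: zc;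
      rewrite zl ltxx.
  by have := connected_component_sub yC; apply.
move=> xc.
pose S := (fun t : R => z + (t%:C)%C * (x - z) : cplx R) @` `[0, 1].
have cS : connected S.
  apply: connected_continuous_connected;
    last exact: continuous_subspaceT (@continuous_segment z x).
  exact: segment_connected.
apply: (@connected_component_max _ _ S) => //.
- by exists 0; rewrite /= ?in_itv /= ?lexx ?ler01 // mul0r addr0.
- move=> _ [t /= /[!in_itv]/= /andP[t0 t1] <-] /= tl; move: tl.
  rewrite mulrDr ReD [(t%:C)%C * _]mulrC mulrA ReZ mulrBr ReB => E.
  suff : c < Re (w * z) + (Re (w * x) - Re (w * z)) * t by rewrite E ltxx.
  move: xc zc; move: (Re _) (Re _) => p q xc zc.
  by have [pq|pq] := lerP p q; nra.
- by exists 1; rewrite /= ?in_itv /= ?lexx ?ler01 // mul1r addrC subrK.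
Qed.

Lemma exists_shift w (d : R) : w != 0 -> 0 < d -> forall x, exists y,
  Re (w * y) = Re (w * x) + d /\ normc (y - x) = d / normc w.
Proof.
move=> w0 d0 x; exists (x + w^-1 * (d%:C)%C); split.
  by rewrite mulrDr ReD mulVKf.
by rewrite addrAC subrr add0r normcM normcV normcR gtr0_norm // mulrC.
Qed.

Lemma closure_above w c : w != 0 ->
  closure (above w c) = [set x | c <= Re (w * x)].
Proof.
move=> w0; have nw := normc_gt0 w0; apply/seteqP; split => x /=.
  move=> /closure_normcP cl; rewrite leNgt; apply/negP => xc.
  have [|y yc yx] := cl ((c - Re (w * x)) / normc w).
    by rewrite divr_gt0 // subr_gt0.
  move: yx; rewrite ltr_pdivlMr // mulrC -normcM mulrBr => yx.
  have := le_lt_trans (ler_norm _) (le_lt_trans (Re_le_normc _) yx).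
  by rewrite ReB ltrD2r ltNge ltW.
move=> xc; apply/closure_normcP => e e0.
have d0 : 0 < e * normc w / 2 by rewrite divr_gt0 // mulr_gt0.
have [y [yE yx]] := exists_shift w0 d0 x; exists y.
  by rewrite /above /= yE; apply: le_lt_trans xc _; rewrite ltrDl.
rewrite yx mulrAC mulfK ?gt_eqF //; lra.
Qed.

Lemma closed_half_plane_of_level w c : w != 0 ->
  closed_half_plane_of (level w c) [set x | c <= Re (w * x)].
Proof.
move=> w0; exists (above w c); split; last by rewrite closure_above.
have [y [yE _]] := @exists_shift w (1 + `|c|) w0 (ltr_pwDl ltr01 (normr_ge0 _))
  0.
have yc : above w c y.
  rewrite /above /= yE mulr0 /= add0r.
  by have := ler_norm c; lra.
exists y; split; first by rewrite /level /= => yl; move: yc;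
  rewrite /above /= yl ltxx.
by rewrite component_above.
Qed.

Lemma real_line_level w c : w != 0 -> real_line (level w c).
Proof.
move=> w0; exists (w^-1 * (c%:C)%C), (w^-1 * 'i%C); split.
  rewrite mulf_neq0 ?invr_neq0 //; apply/eqP => -[]; apply/eqP;
    exact: oner_neq0.
apply/seteqP; split => x /=.
  rewrite /level /= => xc; exists (Im (w * x)) => //.
  rewrite mulrCA -mulrDr; apply: (mulfI w0); rewrite mulVKf //.
  move: xc; case: (w * x) => p q /= ->.
  by apply/eqP; rewrite eq_complex /=; apply/andP; split; apply/eqP; ring.
move=> [t _ <-]; rewrite /level /= mulrDr mulVKf // mulrCA mulVKf //.
by rewrite /=; ring.
Qed.

Lemma real_lineP L : real_line L -> exists w c, w != 0 /\ L = level w c.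
Proof.
(* Multiplication by i b^* sends the direction b to an imaginary number. *)
move=> [a [b [b0 ->]]]; exists ('i%C * b^*%C), (Re ('i%C * b^*%C * a)); split.
  rewrite mulf_neq0 ?conjc_eq0 //; apply/eqP => -[]; apply/eqP;
    exact: oner_neq0.
apply/seteqP; split => x.
  by move=> [t _ <-]; case: a b {b0} => [a1 a2] [b1 b2]; rewrite /level /=;
    ring.
rewrite /level /=; case: x a b b0 => [x1 x2] [a1 a2] [b1 b2].
rewrite eq_complex /= => b0 E.
have n0 : b1 ^+ 2 + b2 ^+ 2 != 0.
  by apply: contraNN b0; rewrite paddr_eq0 ?sqr_ge0 // !sqrf_eq0.
exists (((x1 - a1) * b1 + (x2 - a2) * b2) / (b1 ^+ 2 + b2 ^+ 2)) => //.
have {}E : (x1 - a1) * b2 = (x2 - a2) * b1 by lra.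
set N := b1 ^+ 2 + b2 ^+ 2 in n0 *; set S := _ * b1 + _.
have e1 : S * b1 = (x1 - a1) * N.
  transitivity ((x1 - a1) * N + b2 * ((x2 - a2) * b1 - (x1 - a1) * b2)).
    by rewrite /S /N; ring.
  by rewrite E; ring.
have e2 : S * b2 = (x2 - a2) * N.
  transitivity ((x2 - a2) * N + b1 * ((x1 - a1) * b2 - (x2 - a2) * b1)).
    by rewrite /S /N; ring.
  by rewrite E; ring.
apply/eqP; rewrite eq_complex /= !mul0r subr0 addr0.
by rewrite ![S / N * _]mulrAC e1 e2 !mulfK // !subrKC !eqxx.
Qed.

Lemma level_opp w c : level (- w) (- c) = level w c.
Proof.
by apply/seteqP; split => x; rewrite /level /= mulNr ReN => /eqP;
  rewrite ?eqr_opp => /eqP // ->.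
Qed.

Lemma closed_half_plane_of_levelP w c H : w != 0 ->
  closed_half_plane_of (level w c) H ->
  H = [set x | c <= Re (w * x)] \/ H = [set x | - c <= Re (- w * x)].
Proof.
move=> w0 [P [[z [nz ->]] ->]].
have [zc|zc|zc] := ltgtP (Re (w * z)) c; last by case: nz.
  right; rewrite -level_opp component_above ?closure_above ?oppr_eq0 //.
  by rewrite /above /= mulNr ReN ltrN2.
by left; rewrite component_above ?closure_above.
Qed.

Lemma closed_half_plane0P (H : set (cplx R)) : closed_half_plane0 H ->
  exists2 w, w != 0 & H = [set x | 0 <= Re (w * x)].
Proof.
move=> [L [/real_lineP[w [c [w0 ->]]] L0 /(closed_half_plane_of_levelP w0)]].
have <- : 0 = c by rewrite -L0 mulr0.
rewrite oppr0 => -[->|->]; first by exists w.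
by exists (- w); rewrite ?oppr_eq0.
Qed.

Lemma closed_half_plane_above w c : w != 0 ->
  closed_half_plane [set x | c <= Re (w * x)].
Proof.
move=> w0; exists (level w c); split; first exact: real_line_level.
exact: closed_half_plane_of_level.
Qed.

Lemma closed_half_plane0_above w : w != 0 ->
  closed_half_plane0 [set x | 0 <= Re (w * x)].
Proof.
move=> w0; exists (level w 0); split; first exact: real_line_level.
  by rewrite /level /= mulr0.
exact: closed_half_plane_of_level.
Qed.

End half_planes.

(** * Generic series hit every disk *)

Section sequence_space.
Context {R : realType} (Lam : set (cplx R)).
Implicit Types (lam mu : Omega Lam) (z w : cplx R).

Definition coef lam : nat -> cplx R := fun n => set_val (lam n).

Lemma power_seriesE lam z : power_series lam z = psum (coef lam) z.
Proof. by rewrite psum.unlock. Qed.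

Lemma coef_in lam n : Lam (coef lam n).
Proof. exact: set_valP. Qed.

(** Otherwise sequences agreeing with lam on longer and longer prefixes would
    stay outside O although they converge to lam coordinatewise. *)
Lemma open_cylinder (O : set (Omega Lam)) lam : open O -> O lam ->
  exists N, forall mu, (forall n, (n < N)%N -> mu n = lam n) -> O mu.
Proof.
move=> oO Olam; apply: contrapT => H.
have /choice[mu Hmu] : forall N, exists mu, (forall n,
  (n < N)%N -> mu n = lam n) /\ ~ O mu.
  move=> N; apply: contrapT => HN; apply: H; exists N => mu mulam.
  by apply: contrapT => nO; apply: HN; exists mu.
have cv : mu @ \oo --> lam.
  apply/cvg_sup => i A /= [_ [[B Bop <-] Bi sBA]].
  exists i.+1 => // N /= iN; apply: sBA => /=.
  by rewrite (Hmu N).1.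
have [N _ HN] := cv O (open_nbhs_nbhs (conj oO Olam)).
by case: (Hmu N) => _; apply; exact: (HN N (leqnn N)).
Qed.

Lemma coef_continuous n : continuous (fun lam => coef lam n).
Proof.
move=> lam; apply: (@continuous_comp _ _ _ (fun lam => lam n) set_val).
  exact: (@proj_continuous nat (fun=> (Lam : Type)) n).
exact: initial_continuous.
Qed.

(** Partial sums depend on finitely many coordinates, and the tails are small
    uniformly in lam. *)
Lemma psum_coef_continuous M z :
  (forall x, Lam x -> normc x <= M) -> normc z < 1 ->
  continuous (fun lam => psum (coef lam) z).
Proof.
move=> LM z1 lam; apply/continuous_normcP => e e0.
have cM mu : bounded_by M (coef mu) by move=> n; apply: LM; exact: coef_in.
have M0 := bounded_by_ge0 (cM lam).
have z0 := normc_ge0 z.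
have z1' : 0 < 1 - normc z by rewrite subr_gt0.
pose K := M / (1 - normc z); have K0 : 0 <= K by rewrite divr_ge0 // ltW.
have partial N (d : R) : 0 < d -> \forall mu \near lam,
    normc (series (fun n => coef mu n * z ^+ n) N - series (fun n =>
      coef lam n * z ^+ n) N) < d.
  elim: N d => [|N IH] d d0.
    by apply: (@nearW _ (nbhs lam)) => mu;
      rewrite /series /= !big_geq // subrr normc0.
  have d2 : 0 < d / 2 by rewrite divr_gt0.
  have /continuous_normcP/(_ _ d2) cN := @coef_continuous N lam.
  apply: (@filterS2 _ (nbhs lam) _ _ _ _ _ (IH _ d2) cN) => mu H1 H2.
  rewrite !seriesEnat /= !big_nat_recr //= opprD addrACA -mulrBl.
  rewrite (le_lt_trans (le_normcD _ _)) // [d]splitr ltr_leD //.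
  rewrite normcM normcX (le_trans _ (ltW H2)) // ler_piMr ?normc_ge0 //.
  by rewrite exprn_ile1 // ltW.
have e2 : 0 < e / 2 by rewrite divr_gt0.
have : geometric 1 (normc z) @ \oo --> (0 : R).
  by apply: cvg_geometric; rewrite ger0_norm.
move=> /cvgrPdist_lt/(_ (e / 2 / (2 * K + 1)))[];
  first by rewrite divr_gt0 //; lra.
move=> N _ /(_ N (leqnn N)) /=;
  rewrite sub0r mul1r normrN ger0_norm ?exprn_ge0 // => zN.
apply: (@filterS _ (nbhs lam) _ _ _ _ (partial N _ e2)) => mu H.
rewrite (psum_split N (cM mu) z1) (psum_split N (cM lam) z1).
rewrite opprD addrACA -mulrBr (le_lt_trans (le_normcD _ _)) //
  [e]splitr ltr_leD //.
rewrite normcM normcX; move: zN; rewrite ltr_pdivlMr; last by lra.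
move=> /ltW; apply: le_trans; rewrite ler_wpM2l ?exprn_ge0 //.
have b nu : normc (psum (fun n => coef nu (N + n)%N) z) <= K.
  by apply: psum_le => //; exact: bounded_by_shift.
have := le_normcB (psum (fun n => coef mu (N + n)%N) z) (psum (fun n =>
  coef lam (N + n)%N) z).
by have := b mu; have := b lam; lra.
Qed.

(** Compactness of the unit circle makes the margin in every direction
    uniform. *)
Lemma uniform_direction M : (forall x, Lam x -> normc x <= M) ->
  (forall w, w != 0 -> exists2 x, Lam x & 0 < Re (w * x)) ->
  exists2 d : R, 0 < d &
    forall w, normc w = 1 -> exists2 x, Lam x & d <= Re (w * x).
Proof.
move=> LM dir.
have /compact_near_coveringP nc := @closed_disk_compact R 0 1.
have [] := nc R (0^'+) (fun d w => normc w = 1 -> exists2 x,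
  Lam x & d <= Re (w * x)).
  move=> w /= _; have [->|w0] := eqVneq w 0.
    exists ([set w : cplx R | normc w < 1], setT) => /=.
      split; last exact: filterT.
      by apply/nbhs_normcP; exists 1 => // v; rewrite subr0.
    by move=> [v d] /= [v1 _] v1'; move: v1; rewrite v1' ltxx.
  have [x Lx xw] := dir w w0.
  have x2 : 0 < Re (w * x) / 2 by rewrite divr_gt0.
  exists ([set v : cplx R | Re (w * x) / 2 < Re (x * v)],
    [set d : R | d < Re (w * x) / 2]) => /=.
    split; last exact: nbhs_right_lt.
    have := @continuous_linform R x w.
    move=> /(_ [set y | Re (w * x) / 2 < y]); apply.
    apply: open_nbhs_nbhs; split; first exact: open_gt.
    by rewrite /= [x * w]mulrC; lra.
  move=> [v d] /= [v1 d1] _; exists x => //.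
  by rewrite mulrC (le_trans (ltW d1)) // ltW.
move=> e /= e0 He; exists (e / 2); first by rewrite divr_gt0.
move=> w w1; have := He (e / 2); apply => //=.
- rewrite sub0r normrN gtr0_norm ?divr_gt0 //; lra.
- by rewrite divr_gt0.
- by rewrite subr0 w1.
Qed.

(** A digit x in the direction of s reduces |s| by about d when |s| is large,
    since |s - x|^2 <= |s|^2 - 2 d |s| + M^2; when |s| is small, any digit is
    harmless. *)
Lemma greedy_step M (d rho : R) : (forall x, Lam x -> normc x <= M) -> 0 < d ->
  (forall w, normc w = 1 -> exists2 x, Lam x & d <= Re (w * x)) ->
  2 * M + 2 * d <= rho -> M ^+ 2 <= d * rho ->
  forall s : cplx R, normc s <= rho -> exists2 x,
    Lam x & normc (s - x) <= rho - d / 2.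
Proof.
move=> LM d0 dir rho1 rho2 s srho.
have [x0 Lx0 _] := dir 1 (normc1 _).
have M0 : 0 <= M by apply: le_trans (LM _ Lx0); exact: normc_ge0.
have [small|big] := lerP (normc s) (rho / 2).
  exists x0 => //; have := le_normcB s x0; have := LM _ Lx0; lra.
have s0 : 0 < normc s by lra.
have [|x Lx dx] := dir (s^*%C * ((normc s)^-1%:C)%C).
  rewrite normcM normcR gtr0_norm ?invr_gt0 //.
  suff -> : normc s^*%C = normc s by rewrite mulfV // gt_eqF.
  by case: (s) => a b /=; rewrite sqrrN.
exists x => //.
have {}dx : d * normc s <= Re (s^*%C * x).
  by move: dx; rewrite mulrAC ReZ ler_pdivlMr.
rewrite -(@ler_pXn2r _ 2) ?nnegrE ?normc_ge0 //; last by lra.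
have nx : normc x ^+ 2 <= M ^+ 2 by rewrite ler_pXn2r ?nnegrE ?normc_ge0 // LM.
have -> : normc (s - x) ^+ 2 = normc s ^+ 2 - 2 * Re (s^*%C * x) + normc x ^+ 2.
  by rewrite !normc_sq; case: (s) (x) => a b [a' b'] /=; ring.
move: dx nx; move: (Re _) (normc x) (normc s) s0 big srho =>
  t y n s0 big srho dx nx.
nra.
Qed.

(** Writing s in base 1/z with digits in Lam: for |z| close to 1 the step s
    |-> (s - x) / z can be kept inside a disk of radius rho by greedy_step,
    and psum_greedy then represents s exactly. *)
Lemma greedy_expansion M (rho0 : R) :
  (forall x, Lam x -> normc x <= M) -> 0 <= M ->
  (forall w, w != 0 -> exists2 x, Lam x & 0 < Re (w * x)) ->
  exists2 r : R, r < 1 & forall z s,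
    r < normc z -> normc z < 1 -> normc s <= rho0 ->
    exists lam, psum (coef lam) z = s.
Proof.
move=> LM M0 /(uniform_direction LM)[d d0 dir].
(* The summands are those required by greedy_step, besides rho0 <= rho. *)
pose rho := `|rho0| + M ^+ 2 / d + 2 * M + 2 * d.
have Md : 0 <= M ^+ 2 / d by rewrite divr_ge0 ?sqr_ge0 // ltW.
have n0 := normr_ge0 rho0.
have rhop : 0 < rho by rewrite /rho; lra.
have rho1 : 2 * M + 2 * d <= rho by rewrite /rho; lra.
have rho2 : M ^+ 2 <= d * rho by rewrite -ler_pdivrMl // mulrC /rho; lra.
have rho3 : rho0 <= rho by have := ler_norm rho0; rewrite /rho; lra.
have step := greedy_step LM d0 dir rho1 rho2.
(* For |z| >= r, dividing by z does not undo the gain d / 2 of one step. *)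
pose r := Num.max 0 ((rho - d / 2) / rho).
exists r; first by rewrite gt_max ltr01 ltr_pdivrMr // mul1r; lra.
move=> z s; rewrite gt_max => /andP[z0 zr] z1 srho0.
have zn0 : z != 0 by apply: contraTneq z0 => ->; rewrite normc0 ltxx.
have /choice[g Hg] : forall s : cplx R, exists x : Lam,
    normc s <= rho -> normc (s - set_val x) <= rho - d / 2.
  move=> t; have [tr|tr] := lerP (normc t) rho; last first.
    have [x Lx _] := dir 1 (normc1 _).
    by exists (exist _ x (mem_set Lx)).
  by have [x Lx xs] := step t tr; exists (exist _ x (mem_set Lx)).
pose S n := iter n (fun t => (t - set_val (g t)) / z) s.
exists ((fun n => g (S n)) : Omega Lam).
have Sr : bounded_by rho S.
  elim=> [|n IH]; first exact: le_trans rho3.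
  rewrite /S iterS -/(S n) normcM normcV ler_pdivrMr //.
  apply: le_trans (Hg _ IH) _.
  by move: zr; rewrite ltr_pdivrMr // [normc z * _]mulrC => /ltW.
apply: (@psum_greedy R M _ z S rho) => //.
by move=> n; apply: LM; exact: coef_in.
Qed.

Definition hits (U : set (cplx R)) w (e : R) : set (Omega Lam) :=
  [set lam | exists2 z, U z & normc (psum (coef lam) z - w) < e].

Lemma hits_open M U w e :
  (forall x, Lam x -> normc x <= M) -> U `<=` unit_disk ->
  open (hits U w e).
Proof.
move=> LM UD; rewrite openE => lam [z Uz zw].
have z1 : normc z < 1 by apply/unit_diskE; exact: UD.
have d0 : 0 < e - normc (psum (coef lam) z - w) by rewrite subr_gt0.
have /continuous_normcP/(_ _ d0) := psum_coef_continuous LM z1 (x := lam).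
apply: (@filterS _ (nbhs lam)) => mu; rewrite ltrBrDr => H; exists z => //.
by apply: le_lt_trans H; rewrite -[X in normc (X - w)](subrK (psum (coef lam)
  z)) -addrA le_normcD.
Qed.

(** Keep a finite prefix of the coefficients, choose z in U so close to 1
    that the rest of the series may take the value still needed to reach w,
    by greedy_expansion. *)
Lemma hits_dense M U w e : (forall x, Lam x -> normc x <= M) -> 0 <= M ->
  (forall w, w != 0 -> exists2 x, Lam x & 0 < Re (w * x)) ->
  U `<=` unit_disk -> closure U 1 -> 0 < e -> dense (hits U w e).
Proof.
move=> LM M0 dir UD cU e0 O [lam0 Olam0] oO.
have [N HN] := open_cylinder oO Olam0.
(* A bound for (w - P) / z^N, with P the prescribed partial sum, |z|^N >=
   1/2. *)
pose rho := 2 * (normc w + N%:R * M).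
have [r r1 Hr] := greedy_expansion rho LM M0 dir.
pose eps := Num.min (1 - r) (1 / (2 * N.+1%:R)).
have eps0 : 0 < eps by rewrite lt_min subr_gt0 r1 divr_gt0 // mulr_gt0.
have [z Uz z1e] := (closure_normcP U 1).1 cU eps eps0.
have z1 : normc z < 1 by apply/unit_diskE; exact: UD.
move: z1e; rewrite lt_min => /andP[zr zN].
have ze : 1 - normc z <= normc (z - 1)
  by rewrite -[1 in X in X <= _](normc1 R) normcB; exact: ge_normcB.
have z0 := normc_ge0 z.
have zr' : r < normc z by lra.
(* Bernoulli: as z -> 1 with N fixed, |z|^N stays above 1/2. *)
have bern k : 1 - k%:R * (1 - normc z) <= normc z ^+ k.
  elim: k => [|k IH]; first by rewrite mul0r subr0 expr0.
  rewrite exprS -natr1; have k0 : 0 <= k%:R :> R := ler0n _ _.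
  have : normc z * (1 - k%:R * (1 - normc z)) <= normc z * normc z ^+ k
    by rewrite ler_wpM2l.
  have : 0 <= k%:R * (1 - normc z) ^+ 2 by rewrite mulr_ge0 ?sqr_ge0.
  by move: (_ ^+ k) (k%:R) => T m; lra.
have zN2 : 1 / 2 <= normc z ^+ N.
  apply: le_trans (bern N); have N1 : 0 < 2 * N.+1%:R :> R by rewrite mulr_gt0.
  have : (1 - normc z) * (2 * N.+1%:R) <= 1
    by rewrite -ler_pdivlMr // (le_trans ze) // ltW.
  by rewrite -[N.+1%:R]natr1; move: (N%:R) (normc z) z1 => m t t1; nra.
have zN0 : z ^+ N != 0.
  by apply/eqP => zN0; move: zN2; rewrite -normcX zN0 normc0; lra.
pose P := series (fun n => coef lam0 n * z ^+ n) N.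
have PN : normc P <= N%:R * M.
  rewrite /P seriesEnat /=; elim: (N) => [|k IH];
    first by rewrite big_geq // normc0 mul0r.
  rewrite big_nat_recr //= -natr1 mulrDl mul1r (le_trans (le_normcD _ _)) //
    lerD //.
  rewrite normcM normcX (le_trans _ (LM _ (coef_in lam0 k))) //.
  by rewrite ler_piMr ?normc_ge0 // exprn_ile1 // ltW.
have srho : normc ((w - P) / z ^+ N) <= rho.
  rewrite normcM normcV normcX ler_pdivrMr; last by lra.
  have := le_normcB w P; have := normc_ge0 w; have := normc_ge0 P.
  rewrite /rho; move: (normc w) (normc P) PN (_ ^+ N) zN2 => a b ab T T2; nra.
have [mu muE] := Hr _ _ zr' z1 srho.
pose lam : Omega Lam := fun n => if (n < N)%N then lam0 n else mu (n - N)%N.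
exists lam; split; first by apply: HN => n nN; rewrite /lam nN.
exists z => //.
have lM : bounded_by M (coef lam) by move=> n; apply: LM; exact: coef_in.
rewrite (psum_split N lM z1).
have -> : (fun n => coef lam (N + n)%N) = coef mu.
  by apply/funext => n; rewrite /coef /lam ltnNge leq_addr /= addKn.
have -> : series (fun n => coef lam n * z ^+ n) N = P.
  rewrite /P !seriesEnat /=; apply: eq_big_nat => n /andP[_ nN].
  by rewrite /coef /lam nN.
by rewrite muE mulrC divfK // subrKC subrr normc0.
Qed.

End sequence_space.

(** * Residual sets and the two alternatives *)

Lemma residual_bigcap (T : topologicalType) (D : nat -> set T) (P : set T) :
  (forall n, open (D n) /\ dense (D n)) -> \bigcap_n D n `<=` P -> residual P.
Proof.
move=> oD DP; exists (fun n => ~` D n `&` ~` P); split.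
  move=> n; have [oDn dDn] := oD n; apply/seteqP; split => // x intx.
  have [y [yD yc]] := dDn _ (ex_intro _ x intx) (open_interior _).
  have : closure (~` D n) y.
    apply: closure_subset (interior_subset yD); exact: subIsetl.
  by move/(open_closedC oDn); apply.
apply/seteqP; split => [x Px|x [n _ []//]].
apply: contrapT => H; apply: (Px); apply: DP => n _; apply: contrapT => nD.
by apply: H; exists n.
Qed.

Section target_disks.
Context {R : realType}.

Definition rational_disk (k : nat) : cplx R * R :=
  if unpickle k is Some (p, q, n)
  then (Complex (ratr p) (ratr q), n.+1%:R^-1) else (0, 1).

Lemma rational_disk_gt0 k : 0 < (rational_disk k).2.
Proof. by rewrite /rational_disk; case: unpickle => [[[p q] n]|] //=;
  rewrite invr_gt0. Qed.

Lemma rational_disk_in (y : cplx R) (e : R) : 0 < e -> exists k, forall w,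
  normc (w - (rational_disk k).1) < (rational_disk k).2 -> normc (w - y) < e.
Proof.
move=> e0.
have e3 : 0 < e / 3 by rewrite divr_gt0.
have app (x : R) : exists p : rat, `|ratr p - x| < e / 3.
  have [|p] := @rat_in_itvoo R (x - e / 3) (x + e / 3); first by lra.
  by rewrite in_itv /= => /andP[p1 p2]; exists p; rewrite ltr_distl p1.
have [p Hp] := app (Re y); have [q Hq] := app (Im y).
have [n Hn] : exists n : nat, n.+1%:R^-1 < e / 3.
  have [n _ /(_ n (leqnn _)) Hn] := near_infty_natSinv_lt (PosNum e3).
  by exists n.
exists (pickle (p, q, n)) => w; rewrite /rational_disk pickleK /= => wc.
set c : cplx R := Complex _ _ in wc.
have cy : normc (c - y) < e / 3 + e / 3.
  rewrite (le_lt_trans (normc_le_ReIm _)) //.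
  by move: Hp Hq; rewrite /c; case: (y) => a b /= Hp Hq; rewrite ltrD.
have -> : w - y = (w - c) + (c - y) by rewrite addrA subrK.
by have wc3 := lt_trans wc Hn; rewrite (le_lt_trans (le_normcD _ _)) //;
  move: wc3 cy; move: (normc _) (normc _) => s t; lra.
Qed.

Lemma dense_rational_disks (A : set (cplx R)) :
  (forall k, exists2 w, A w & normc (w - (rational_disk k).1) < (rational_disk
    k).2) ->
  dense A.
Proof.
move=> HA O [y Oy] /open_normcP/(_ y Oy)[e /(rational_disk_in y)[k Hk] HO].
have [w Aw wk] := HA k.
by exists w; split => //; apply: HO; exact: Hk.
Qed.

End target_disks.

Section two_parts.
Context {R : realType} (Lam : set (cplx R)).

Lemma bounded_set_normc : bounded_set Lam ->
  exists2 M : R, 0 <= M & forall x, Lam x -> normc x <= M.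
Proof.
move=> /pinfty_ex_gt0[M M0 LM].
have ME : M = ((Re M)%:C)%C by rewrite RRe_real // gtr0_real.
exists (Re M); first by move: M0; rewrite ME ltcR => /ltW.
by move=> x Lx; rewrite -lecR -normE -ME; exact: LM.
Qed.

(** Density of the image excludes constant series, so that the hypothesis of
    the open mapping theorem costs no further generic condition. *)
Lemma dense_psum_nonconstant M a (U : set (cplx R)) : bounded_by M a ->
  U `<=` unit_disk -> dense (psum a @` U) -> ~ (forall n, a n.+1 = 0).
Proof.
move=> aM UD dU a0.
have aE z : normc z < 1 -> psum a z = a 0%N.
  move=> z1; rewrite (psum_recl aM z1).
  have b0 : bounded_by 0 (fun n => a n.+1) by move=> n; rewrite a0 normc0.
  have := psum_le b0 z1; rewrite mul0r => H.
  rewrite (_ : psum _ z = 0) ?mulr0 ?addr0 //.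
  by apply: eq0_normc; apply/eqP; rewrite eq_le H normc_ge0.
have [||w []] := dU [set w | normc (w - (a 0%N + 1)) < 1].
- by exists (a 0%N + 1); rewrite /= subrr normc0.
- exact: open_disk.
- move=> /= w1 [z Uz zw]; move: w1; rewrite -zw aE; last by apply/unit_diskE;
  exact: UD.
  by rewrite opprD addNKr normcN normc1 ltxx.
Qed.

Lemma generic_dense_open : bounded_set Lam ->
  ~ (exists H, closed_half_plane0 H /\ Lam `<=` H) ->
  forall U : set (cplx R), open U -> U `<=` unit_disk -> closure U 1 ->
  generically (fun lam : Omega Lam =>
    dense (power_series lam @` U) /\ open (power_series lam @` U)).
Proof.
move=> /bounded_set_normc[M M0 LM] nH U oU UD cU.
have dir w : w != 0 -> exists2 x, Lam x & 0 < Re (w * x).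
  move=> w0; apply: contrapT => H; apply: nH.
  exists [set x | 0 <= Re (- w * x)]; split.
    by apply: closed_half_plane0_above; rewrite oppr_eq0.
  move=> x Lx /=; rewrite mulNr ReN oppr_ge0 leNgt; apply/negP => xw.
  by apply: H; exists x.
apply: (@residual_bigcap _
  (fun k => hits U (@rational_disk R k).1 (@rational_disk R k).2)).
  move=> k; split; first exact: (hits_open _ _ LM UD).
  exact: (hits_dense _ LM M0 dir UD cU (rational_disk_gt0 k)).
move=> lam hlam /=.
have -> : power_series lam = psum (coef lam).
  by apply/funext => z; exact: power_seriesE.
have cM : bounded_by M (coef lam) by move=> n; apply: LM; exact: coef_in.
have dU : dense (psum (coef lam) @` U).
  apply: dense_rational_disks => k; have [z Uz zk] := hlam k I.
  by exists (psum (coef lam) z) => //; exists z.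
split => //; apply: (psum_open cM _ oU UD).
exact: dense_psum_nonconstant cM UD dU.
Qed.

Lemma Re_psum_ge0 M a w (x : R) : bounded_by M a -> 0 <= x < 1 ->
  (forall n, 0 <= Re (w * a n)) -> 0 <= Re (w * psum a (x%:C)%C).
Proof.
move=> aM /andP[x0 x1] wa.
have nx : normc (x%:C)%C < 1 by rewrite normcR ger0_norm.
have cv := psum_cvg aM nx.
rewrite leNgt; apply/negP => neg.
have nb : nbhs (psum a (x%:C)%C) [set y | Re (w * y) < 0].
  apply: (@continuous_linform R w _ [set t | t < 0]).
  by apply: open_nbhs_nbhs; split; first exact: open_lt.
have [N _ /(_ N (leqnn N)) /=] := cv _ nb.
apply/negP; rewrite -leNgt seriesEnat /=.
elim: N => [|N IH]; first by rewrite big_geq // mulr0.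
rewrite big_nat_recr //= mulrDr ReD addr_ge0 // mulrA -rmorphXn ReZ.
by rewrite mulr_ge0 // exprn_ge0.
Qed.

(** U is a neighbourhood of ]0, 1[ that narrows quadratically at 1. On ]0, 1[
    the values stay in the closed convex cone Re (w y) >= 0, and on U they
    are within distance 1 of it. *)
Lemma half_plane_avoided : bounded_set Lam ->
  (exists H, closed_half_plane0 H /\ Lam `<=` H) ->
  exists U H : set (cplx R),
   [/\ open U, U `<=` unit_disk, closure U 1, closed_half_plane H &
       forall lam : Omega Lam, (power_series lam @` U) `&` H = set0].
Proof.
move=> /bounded_set_normc[M M0 LM] [_ [/closed_half_plane0P[w w0 ->] Lw]].
have nw := normc_gt0 w0.
(* The width eta (1 - x)^2 makes the series at z and at x differ by at most
   1, by psum_lipschitz. *)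
pose eta := (2 * (M + 1))^-1.
have M1 : 0 < 2 * (M + 1) by lra.
have eta0 : 0 < eta by rewrite invr_gt0.
have etaM : eta * (2 * (M + 1)) = 1 by rewrite mulVf // gt_eqF.
have eta2 : eta <= 1 / 2 by nra.
pose U := [set z : cplx R | exists2 x : R, 0 < x < 1 &
  normc (z - (x%:C)%C) < eta * (1 - x) ^+ 2].
have Uz z x : 0 < x < 1 -> normc (z - (x%:C)%C) < eta * (1 - x) ^+ 2 ->
    (1 - x) / 2 <= 1 - normc z.
  move=> /andP[x0 x1] zx.
  have := le_normcD (z - (x%:C)%C) (x%:C)%C;
    rewrite subrK normcR gtr0_norm // => H.
  suff : eta * (1 - x) ^+ 2 <= (1 - x) / 2 by lra.
  by rewrite expr2; nra.
have UD : U `<=` unit_disk.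
  move=> z [x x01 /(Uz z x x01) H]; apply/unit_diskE.
  by move/andP: x01 => [x0 x1]; lra.
exists U, [set y | 2 * normc w <= Re (- w * y)]; split => //.
- apply/open_normcP => z [x x01 zx].
  have [d d0 Hd] := (open_normcP _).1 (@open_disk R (x%:C)%C (eta * (1 - x) ^+
    2)) z zx.
  by exists d => // y /Hd yx; exists x.
- apply/closure_normcP => e e0.
  pose t := Num.min e 1 / 2.
  have m0 : 0 < Num.min e 1 by rewrite lt_min e0 ltr01.
  have /andP[te t1] : (t < e) && (t < 1) by rewrite -lt_min /t; lra.
  have t0 : 0 < t by rewrite divr_gt0.
  exists ((1 - t)%:C)%C.
    exists (1 - t); first by lra.
    by rewrite subrr normc0 mulr_gt0 // exprn_gt0 //; lra.
  by rewrite rmorphB rmorph1 addrAC subrr add0r normcN normcR gtr0_norm.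
- by apply: closed_half_plane_above; rewrite oppr_eq0.
move=> lam; apply/seteqP; split => // _ [[z [x x01 zx] <-]] /=.
rewrite power_seriesE mulNr ReN.
have cM : bounded_by M (coef lam) by move=> n; apply: LM; exact: coef_in.
have zd := Uz z x x01 zx; have /andP[x0 x1] := x01.
have z1 : normc z < 1 by lra.
have nx : normc ((x%:C)%C : cplx R) = x by rewrite normcR gtr0_norm.
have x1' : normc ((x%:C)%C : cplx R) < 1 by rewrite nx.
have := psum_lipschitz cM x1' z1; rewrite nx => lip.
have Rx : 0 <= Re (w * psum (coef lam) (x%:C)%C).
  apply: (Re_psum_ge0 cM); first by rewrite ltW.
  by move=> n; exact: (Lw _ (coef_in lam n)).
have close : normc (psum (coef lam) z - psum (coef lam) (x%:C)%C) <= 1.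
  apply: le_trans lip _.
  have p1 : 0 < 1 - x by lra.
  have p2 : 0 < 1 - normc z by lra.
  rewrite !mulrA ler_pdivrMr // mul1r ler_pdivrMr //.
  have : (1 - x) ^+ 2 / 2 <= (1 - normc z) * (1 - x) by rewrite expr2; nra.
  apply: le_trans; apply: le_trans (ler_wpM2r M0 (ltW zx)) _.
  have : 0 <= (1 - x) ^+ 2 by exact: sqr_ge0.
  by move: (_ ^+ 2) => T T0; nra.
have := le_trans (ler_norm _) (Re_le_normc (- (w * (psum (coef lam) z - psum
  (coef lam) (x%:C)%C)))).
rewrite normcN normcM ReN mulrBr ReB => H1 H2.
have : normc w * normc (psum (coef lam) z - psum (coef lam) (x%:C)%C) <= normc
  w.
  by rewrite ler_piMr // ltW.
by lra.
Qed.
End two_parts.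

Theorem theorem3 (R : realType) (Lam : set (cplx R))
  (Lam_bounded : bounded_set Lam)
  (Lam_two : exists a b : cplx R, [/\ Lam a, Lam b & a <> b])
  (Omega_baire : baire_space (Omega Lam)) :
  ((~ exists H : set (cplx R), closed_half_plane0 H /\ Lam `<=` H) ->
   forall U : set (cplx R),
     open U -> U `<=` unit_disk -> closure U 1 ->
     generically (fun lam : Omega Lam =>
       dense (power_series lam @` U) /\ open (power_series lam @` U)))
  /\
  ((exists H : set (cplx R), closed_half_plane0 H /\ Lam `<=` H) ->
   exists U H : set (cplx R),
     [/\ open U, U `<=` unit_disk, closure U 1, closed_half_plane H &
         forall lam : Omega Lam, (power_series lam @` U) `&` H = set0]).
Proof.
split; first exact: generic_dense_open.
exact: half_plane_avoided.
Qed.
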